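(* Let $m\ge 5$, $X=\mathbb{F}_{2^m}\setminus\{0,1\}$, and let $W_2,W_5$ be as in the context. Then the triple $(X,W_2,W_5)$ is a $\mathrm{GDD}(2^m-2,2,5)$ with balance parameter $\lambda_5=\frac{(2^m-8)(2^m-16)}{3!}$.
   Context: $\mathbb{F}_{2^m}$ is the finite field with $2^m$ elements, with zero $0$ and unity $1$; all sums are in $\mathbb{F}_{2^m}$. For each integer $k\ge 2$, $W_k=\{B\subset X : |B|=k,\ \sum_{i\in B} i=1,\ \text{and } \binom{B}{\ell}\cap W_\ell=\emptyset \text{ for all } 2\le \ell\le k-3\}$ (recursive definition; $\binom{B}{\ell}$ is the set of $\ell$-subsets of $B$). A group divisible design $\mathrm{GDD}(v,n,k)$ is a triple $(X,\mathcal{G},\mathcal{B})$ where $X$ is a $v$-set, $\mathcal{G}$ is a collection of $n$-subsets of $X$ (groups) and $\mathcal{B}$ is a collection of $k$-subsets of $X$ (blocks), such that (i) $\mathcal{G}$ is a partition of $X$; (ii) no two elements of a block lie together in a common group; (iii) every pair of distinct elements of $X$ from different groups occurs together in exactly $\lambda$ blocks; $\lambda$ is called the balance parameter. *)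

(* Defs.v *)
From HB Require Import structures.
From mathcomp Require Import all_boot all_order all_algebra.

Set Implicit Arguments.
Unset Strict Implicit.
Unset Printing Implicit Defensive.

Import GRing.Theory.

Definition ksubsets (T : finType) (B : {set T}) (l : nat) : {set {set T}} :=
  [set A : {set T} | (A \subset B) && (#|A| == l)].

Record is_gdd (T : finType) (X : {set T}) (Gs Bs : {set {set T}})
    (v n k lambda : nat) : Prop := IsGDD {
  gdd_points : #|X| = v;
  gdd_groups : Gs \subset ksubsets X n;
  gdd_blocks : Bs \subset ksubsets X k;
  gdd_partition : partition Gs X;
  gdd_transverse : forall B G x y, B \in Bs -> G \in Gs ->
    x \in B -> y \in B -> x != y -> ~~ ((x \in G) && (y \in G));
  gdd_balance : forall G1 G2 x y, G1 \in Gs -> G2 \in Gs -> G1 != G2 ->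
    x \in G1 -> y \in G2 ->
    #|[set B in Bs | (x \in B) && (y \in B)]| = lambda
}.

Lemma ltn_well_founded : well_founded (fun i j : nat => i < j).
Proof. by elim/ltn_ind => k IHk; constructor => l /IHk. Qed.

Section OneSumBlocks.

Variable F : finFieldType.

Definition X01 : {set F} := ~: [set 0%R; 1%R].

Definition W_step (k : nat) (Wlt : forall l : nat, l < k -> {set {set F}}) :
    {set {set F}} :=
  [set B in ksubsets X01 k |
    (\sum_(i in B) i == 1 :> F)%R &&
    [forall l : 'I_k, (2 <= l <= k - 3) ==>
       (ksubsets B l :&: Wlt l (ltn_ord l) == set0)]].

(* The truncated k - 3 makes the last condition void for k < 5, as it
   should be. The intended range is k >= 2; W 0 and W 1 are empty. *)
Definition W : nat -> {set {set F}} :=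
  Fix ltn_well_founded (fun _ => {set {set F}}) (@W_step).

Lemma W_unfold k : W k = @W_step k (fun l _ => W l).
Proof.
rewrite /W Fix_eq // => j f g fg; apply/setP => B; rewrite !inE.
by congr (_ && (_ && _)); apply: eq_forallb => l; rewrite fg.
Qed.

Lemma in_W k (B : {set F}) :
  reflect [/\ B \subset X01, #|B| = k, (\sum_(i in B) i = 1 :> F)%R &
             forall l, 2 <= l <= k - 3 -> ksubsets B l :&: W l = set0]
          (B \in W k).
Proof.
rewrite W_unfold !inE; apply: (iffP idP).
  case/andP=> /andP[sBX /eqP cB] /andP[/eqP sB /forallP H]; split=> // l Hl.
  have lk : l < k.
    case/andP: Hl => l2 lk3; have k3: 0 < k - 3 by apply: leq_trans lk3; case: l l2.
    by apply: leq_ltn_trans lk3 _; rewrite ltn_subrL /=; case: k k3 {cB H}.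
  by apply/eqP; move: (H (Ordinal lk)); rewrite /= Hl.
case=> sBX -> -> H; rewrite sBX !eqxx /=; apply/forallP=> l.
by apply/implyP=> Hl; apply/eqP/H.
Qed.

End OneSumBlocks.

(* Main.v *)
Require Import Defs.
From mathcomp Require Import all_boot all_order all_algebra.
From mathcomp Require Import finfield ring zify.

(** Fix points [x], [y] in different groups, so that [1], [x], [y] are linearly
    independent over the prime field.  A block through [x] and [y] is
    [{x, y, a, b, 1 + x + y + a + b}], and the conditions defining [W 5] amount
    to saying that [1, x, y, a, b] are linearly independent.  There are
    [(2 ^ m - 8) * (2 ^ m - 16)] such ordered pairs [(a, b)], and every block
    arises from exactly [3!] of them. *)

Set Implicit Arguments.
Unset Strict Implicit.

Import GRing.Theory.

Section CharacteristicTwo.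

Variable F : finFieldType.
Hypothesis char2 : (2%:R = 0 :> F)%R.

Local Open Scope ring_scope.

Implicit Types (x y z a b : F) (A B G V : {set F}) (s : seq F).

(** * Spans over the prime field in characteristic two *)

Lemma addrr2 z : z + z = 0.
Proof. by ring: char2. Qed.

Lemma addrK2 x y : x + y + y = x.
Proof. by ring: char2. Qed.

Lemma addr2_eq0 x y : (x + y == 0) = (x == y).
Proof. by apply/eqP/eqP => [xy|->]; rewrite ?addrr2 // -[x](addrK2 x y) xy add0r. Qed.

(** For an additive subgroup [V] this is its span with [a] over the prime field. The condition
    [z + a \in V] describes the translate of [V] by [a], as [a = - a]; membership thus unfolds to
    plain equations. *)
Definition adjoin V a : {set F} := V :|: [set z | z + a \in V].

Lemma in_adjoin V a z : (z \in adjoin V a) = (z \in V) || (z + a \in V).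
Proof. by rewrite !inE. Qed.

Lemma adjoin_closed V a : {in V &, forall u v, u + v \in V} ->
  {in adjoin V a &, forall u v, u + v \in adjoin V a}.
Proof.
move=> clV u v; rewrite !in_adjoin => /orP[] uV /orP[] vV; apply/orP.
- by left; apply: clV.
- by right; have -> : u + v + a = u + (v + a); [ring | apply: clV].
- by right; have -> : u + v + a = u + a + v; [ring | apply: clV].
- by left; have -> : u + v = (u + a) + (v + a); [ring: char2 | apply: clV].
Qed.

(** The translate by [a] has as many elements as [V], and it is disjoint from [V]: a common [z]
    would give [a = z + (z + a)] in [V]. *)
Lemma card_adjoin V a : {in V &, forall u v, u + v \in V} -> a \notin V ->
  #|adjoin V a| = (2 * #|V|)%N.
Proof.
move=> clV aV; have inj : injective (+%R^~ a) by apply: addIr.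
have shiftE : [set z | z + a \in V] = (+%R^~ a) @: V.
  apply/setP => z; rewrite inE; apply/idP/imsetP => [zV|[w wV ->]].
    by exists (z + a) => //; rewrite addrK2.
  by rewrite addrK2.
rewrite /adjoin cardsU (_ : _ :&: _ = set0) ?cards0 ?subn0.
  by rewrite shiftE card_imset // mul2n addnn.
apply/setP => z; rewrite !inE; apply/negP => /andP[zV zaV].
by case/negP: aV; have -> : a = z + (z + a); [ring: char2 | apply: clV].
Qed.

Definition span1 : {set F} := adjoin [set 0] 1.
Definition span3 x y : {set F} := adjoin (adjoin span1 x) y.

Lemma span1_closed : {in span1 &, forall u v, u + v \in span1}.
Proof. by apply: adjoin_closed => u v /set1P-> /set1P->; rewrite addr0 inE. Qed.

Lemma card_span1 : #|span1| = 2%N.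
Proof.
rewrite card_adjoin ?cards1 ?inE ?oner_neq0 // => u v /set1P-> /set1P->.
by rewrite addr0 inE.
Qed.

Lemma span3_closed x y : {in span3 x y &, forall u v, u + v \in span3 x y}.
Proof. by do 2!apply: adjoin_closed; apply: span1_closed. Qed.

Lemma card_span3 x y : x \notin span1 -> y \notin adjoin span1 x ->
  #|span3 x y| = 8%N.
Proof.
move=> xV yV; have cl1 := span1_closed.
by rewrite (card_adjoin (adjoin_closed cl1) yV) (card_adjoin cl1 xV) card_span1.
Qed.

Lemma X01_span1 x : (x \in X01 F) = (x \notin span1).
Proof. by rewrite in_adjoin !inE addr2_eq0. Qed.

(** For a list of length 5 and sum 1, this amounts to its set of entries being a block of [W 5];
    [u + v != 0] encodes distinctness. Every condition is a sum different from zero, so that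
    conditions can be compared by [ring]. *)
Definition admissible s :=
  all [pred z | (z != 0) && (z + 1 != 0)] s &&
  pairwise [rel u v | (u + v != 0) && (u + v + 1 != 0)] s.

Definition fifth x y a b : F := 1 + x + y + a + b.

(* Up to reordering in characteristic two, the 30 inequations of each side are
   the same; the tactic below matches them one by one. *)
Lemma admissible_span x y a b :
  x \notin span1 -> y \notin adjoin span1 x ->
  admissible [:: x; y; a; b; fifth x y a b] =
  (a \notin span3 x y) && (b \notin adjoin (span3 x y) a).
Proof.
rewrite /admissible /span3 /span1 /fifth /= !in_adjoin !in_set1 !negb_or.
move=> hx hy; apply/idP/idP => H; move: hx hy H;
  rewrite -?andbA ?andbT => hx hy H;
  repeat match goal with K : is_true (_ && _) |- _ => case/andP: K => ? ? end;
  repeat (apply/andP; split) => //;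
  match goal with
  | K : is_true (?v != 0) |- is_true (?u != 0) =>
      have -> : u = v; [by ring: char2 | exact: K]
  end.
Qed.

(** * The groups *)

Lemma in_W2 B : (B \in W F 2) =
  [&& B \subset X01 F, #|B| == 2%N & \sum_(z in B) z == 1].
Proof.
apply/in_W/and3P => [[sB cB sumB _]|[sB /eqP cB /eqP sumB]]; first by rewrite cB sumB !eqxx.
(* Here [2 - 3] truncates to [0], so no [l] is in range. *)
by split=> // l /andP[l2]; case: l l2.
Qed.

Lemma W2_pair x : x \in X01 F -> [set x; x + 1] \in W F 2.
Proof.
move=> xX; have x1 : x != x + 1 by rewrite -addr2_eq0 addrA addrr2 add0r oner_neq0.
rewrite in_W2 cards2 x1 eqxx big_setU1 ?inE // big_set1 /=.
rewrite addrA addrr2 add0r eqxx !andbT; apply/subsetP => z.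
rewrite !inE => /orP[] /eqP->; move: xX; rewrite !inE //.
by rewrite addr2_eq0 -(addr2_eq0 (x + 1) 1) addrK2 orbC.
Qed.

(** The only partner of [x] with sum [1] is [x + 1], so the groups are the cosets of the prime field
    other than itself. *)
Lemma W2_eq G x : G \in W F 2 -> x \in G -> G = [set x; x + 1].
Proof.
move=> /[swap] xG; rewrite in_W2 => /and3P[_ /cards2P[u [v [uv defG]]]].
rewrite defG big_setU1 ?inE // big_set1 /= => /eqP suv; move: xG.
rewrite defG => /set2P[] ->; rewrite -suv; first by congr [set _; _]; ring: char2.
by rewrite setUC; congr [set _; _]; ring: char2.
Qed.

Lemma W2_sub G : G \in W F 2 -> G \subset X01 F.
Proof. by rewrite in_W2 => /and3P[]. Qed.

Lemma W2_partition : partition (W F 2) (X01 F).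
Proof.
apply/and3P; split.
- rewrite eqEsubset; apply/andP; split; apply/subsetP => x.
    by case/bigcupP => G /W2_sub/subsetP; apply.
  by move=> xX; apply/bigcupP; exists [set x; x + 1]; [exact: W2_pair | rewrite set21].
- apply/trivIsetP => A B AW BW; apply: contraR => /pred0Pn[x /andP[/= xA xB]].
  by rewrite (W2_eq AW xA) (W2_eq BW xB).
- by rewrite in_W2 cards0 andbF.
Qed.

(** * The blocks, as sets and as lists *)

Lemma W5P B : reflect [/\ B \subset X01 F, #|B| = 5%N, \sum_(z in B) z = 1 &
    {in B &, forall u v, u != v -> u + v != 1}] (B \in W F 5).
Proof.
apply: (iffP (in_W _ _)) => -[sB cB sumB W2B]; split=> //.
  move=> u v uB vB uv; apply/negP => /eqP suv.
  have /setP/(_ [set u; v]) := W2B 2%N isT.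
  rewrite in_set0 inE in_W2 inE cards2 uv eqxx andbT big_setU1 ?inE // big_set1 /=.
  rewrite suv eqxx andbT; suff sub A : u \in A -> v \in A -> [set u; v] \subset A.
    by rewrite !sub //; apply: (subsetP sB).
  by move=> uA vA; apply/subsetP => z /set2P[] ->.
move=> l l2; have {l l2}-> : l = 2%N by lia.
apply/setP => A; rewrite in_set0 inE in_W2 inE; apply/negP.
case/andP => /andP[sAB _] /and3P[_ /cards2P[u [v [uv defA]]]]; move: sAB.
rewrite defA big_setU1 ?inE // big_set1 /= => /subsetP sAB.
by apply/negP/W2B => //; apply: sAB; rewrite !inE eqxx ?orbT.
Qed.

Lemma W5_admissible B s : B \in W F 5 -> uniq s -> {subset s <= B} -> admissible s.
Proof.
case/W5P => /subsetP sB _ _ nB us sub; apply/andP; split.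
  apply/allP => z /sub/sB; rewrite /= !inE negb_or.
  by rewrite addr2_eq0.
have subP : all [in B] s by apply/allP.
rewrite uniq_pairwise in us; apply: sub_in_pairwise subP us => u v uB vB /= uv.
by rewrite !addr2_eq0 uv nB.
Qed.

Lemma admissible_uniq s : admissible s -> uniq s.
Proof.
case/andP => _; rewrite uniq_pairwise; apply: sub_pairwise => u v /=.
by rewrite addr2_eq0 => /andP[].
Qed.

Lemma admissible_W5 s : admissible s -> size s = 5%N -> \sum_(z <- s) z = 1 ->
  [set z in s] \in W F 5.
Proof.
move=> adm s5 sum1; have us := admissible_uniq adm; case/andP: adm => /allP s01 pw.
apply/W5P; split.
- by apply/subsetP => z; rewrite !inE negb_or => /s01 /=; rewrite addr2_eq0.
- by rewrite cardsE (card_uniqP us).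
- by rewrite -sum1 big_uniq //=; apply: eq_bigl => z; rewrite inE.
move=> u v; rewrite !inE => us' vs' uv.
(* [pairwise] only sees entries in list order. Weakening the relation to a reflexive and symmetric
   one extends it to all pairs of entries. *)
have : pairwise [rel u v | (u == v) || (u + v != 1)] s.
  by apply: sub_pairwise pw => w z /=; rewrite !addr2_eq0 => /andP[_ ->]; rewrite orbT.
rewrite pairwise_all2rel => [/allrelP/(_ u v us' vs')||w z] /=.
- by rewrite (negPf uv).
- by move=> w; rewrite /= eqxx.
- by rewrite /= eq_sym addrC.
Qed.

(** * Counting the blocks through two points *)

Lemma W5_balance x y : x \notin span1 -> y \notin adjoin span1 x ->
  (6 * #|[set B in W F 5 | (x \in B) && (y \in B)]| = (#|F| - 8) * (#|F| - 16))%N.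
Proof.
move=> hx hy; set bl := [set B in _ | _]; set V := span3 x y.
pose T := [set p : F * F | (p.1 \notin V) && (p.2 \notin adjoin V p.1)].
pose l (p : F * F) := [:: x; y; p.1; p.2; fifth x y p.1 p.2].
pose f p : {set F} := [set z in l p].
have admT p : admissible (l p) = (p \in T) by rewrite inE admissible_span.
have cardT : #|T| = ((#|F| - 8) * (#|F| - 16))%N.
  (* [V] has 8 elements, and adjoining a new [a] doubles this to 16. *)
  transitivity (\sum_(a | a \notin V) \sum_(b | b \notin adjoin V a) 1)%N.
    by rewrite pair_big_dep sum1dep_card.
  rewrite (eq_bigr (fun=> (#|F| - 16)%N)) => [|a aV]; last first.
    rewrite sum1dep_card (_ : [set _ | _] = ~: adjoin V a); last first.
      by apply/setP => z; rewrite !inE.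
    by rewrite cardsCs setCK card_adjoin ?card_span3 //; apply: span3_closed.
  rewrite sum_nat_cond_const (_ : [set _ | _] = ~: V); last by apply/setP => z; rewrite !inE.
  by rewrite cardsCs setCK card_span3.
have f_bl p : p \in T -> f p \in bl.
  move=> pT; rewrite !inE !eqxx orbT !andbT admissible_W5 ?admT //.
  by rewrite !big_cons big_nil /fifth; ring: char2.
(* Double counting: [T] is split into the fibres of [f], and each fibre is shown to have 6
   elements. *)
rewrite -cardT -[RHS]sum1_card (partition_big f (mem bl)) //= mulnC -sum_nat_const.
apply: eq_bigr => B; rewrite inE => /and3P[BW xB yB]; pose D := B :\ x :\ y.
have [_ cB sumB _] := W5P _ BW.
have xy : y != x.
  by move: hy; rewrite /span1 !in_adjoin !in_set1 !negb_or !addr2_eq0 => /andP[_ /andP[]].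
have yBx : y \in B :\ x by rewrite !inE xy.
have cD : #|D| = 3%N by move: cB; rewrite (cardsD1 x) xB (cardsD1 y) yBx => -[].
(* The fibre over [B] consists of the ordered pairs of distinct elements of [D], which has three
   elements. *)
transitivity (\sum_(a in D) \sum_(b in D :\ a) 1)%N.
  rewrite (eq_bigr (fun=> 2%N)) ?sum_nat_const ?cD // => a aD.
  by rewrite sum1_card; move: cD; rewrite (cardsD1 a) aD => -[].
rewrite pair_big_dep; apply: eq_bigl => -[a b] /=; apply/andP/andP => [[aD bD]|].
  (* One element of [D] remains, and the sum of [B] forces it to be [fifth x y a b]. *)
  have cE : #|D :\ a :\ b| == 1%N.
    by move: cD; rewrite (cardsD1 a) aD (cardsD1 b) bD => /eqP.
  have /cards1P[c defE] := cE.
  have defc : c = fifth x y a b.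
    move: sumB; rewrite (big_setD1 x) // (big_setD1 y) // (big_setD1 a) //.
    rewrite (big_setD1 b) // defE big_set1 /fifth /= => <- /=.
    by ring: char2.
  have cD' : c \in D :\ a :\ b by rewrite defE set11.
  have subB : {subset l (a, b) <= B}.
    move: aD bD cD'; rewrite /l -defc !inE => /and3P[_ _ aB] /and4P[_ _ _ bB].
    case/and5P=> _ _ _ _ cB' z; rewrite !inE.
    by do 4?case/orP; move=> /eqP->.
  have ul : uniq (l (a, b)).
    move: aD bD cD'; rewrite /l -defc !inE /= !inE !negb_or.
    rewrite !(eq_sym x) !(eq_sym y a) !(eq_sym y b) !(eq_sym y c).
    rewrite !(eq_sym a b) !(eq_sym a c) !(eq_sym b c) xy.
    by case/and3P=> -> -> _ /and4P[-> -> -> _] /and5P[-> -> -> -> _].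
  rewrite -admT (W5_admissible BW) //; split=> //.
  rewrite eqEcard cB cardsE (card_uniqP ul) leqnn andbT.
  by apply/subsetP => z; rewrite inE; apply: subB.
(* Conversely, an admissible list has no repetition, so [a] and [b] differ from [x], [y] and each
   other. *)
case; rewrite -admT /D => /admissible_uniq ul /eqP <-; move: ul.
rewrite /f /l !inE /= !inE !negb_or !eqxx !orbT !andbT.
rewrite !(eq_sym x) !(eq_sym y a) !(eq_sym y b) !(eq_sym a b).
by case/and4P=> /and4P[_ -> -> _] /and3P[-> -> _] /andP[-> _] _.
Qed.

(** * The design and its balance parameter *)

Lemma W5_gdd n : #|F| = n ->
  is_gdd (X01 F) (W F 2) (W F 5) (n - 2) 2 5 ((n - 8) * (n - 16) %/ 6).
Proof.
move=> cF; split.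
- by rewrite cardsCs setCK cards2 eq_sym oner_neq0 cF.
- by apply/subsetP => G; rewrite in_W2 inE => /and3P[-> ->].
- by apply/subsetP => B /W5P[sB cB _ _]; rewrite inE sB cB eqxx.
- exact: W2_partition.
- move=> B G x y /W5P[_ _ _ nB] GW xB yB xy; apply/negP => /andP[xG yG].
  move: yG (nB _ _ xB yB xy); rewrite (W2_eq GW xG) !inE eq_sym (negPf xy) /=.
  by move/eqP->; rewrite addrA addrr2 add0r eqxx.
move=> G1 G2 x y G1W G2W neqG xG1 yG2.
have xX := subsetP (W2_sub G1W) _ xG1; have yX := subsetP (W2_sub G2W) _ yG2.
rewrite -cF -(@W5_balance x y) ?mulKn -?X01_span1 //.
(* It remains to see that [y + x] is neither [0] nor [1]; otherwise [y] would be [x] or [x + 1],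
   hence in [G1]. *)
rewrite in_adjoin negb_or -!X01_span1 yX !inE; apply: contra neqG => y_x.
suff yG1 : y \in G1 by rewrite (W2_eq G1W yG1) (W2_eq G2W yG2).
rewrite (W2_eq G1W xG1) !inE -(addr2_eq0 y x).
by rewrite -(addr2_eq0 y (x + 1)) addrA (addr2_eq0 (y + x)).
Qed.

End CharacteristicTwo.

(** Write [2 ^ m = 32 * t] with [t] prime to 3. Modulo 3 the factors are [2 * t - 2] and
    [2 * t - 1], so 3 divides the first if [t] is 1 and the second if [t] is 2; the other factor is
    even. *)
Lemma dvdn6_pow2 m : 5 <= m -> 6 %| (2 ^ m - 8) * (2 ^ m - 16).
Proof.
move=> m5; rewrite -(subnKC m5) expnD; move: (m - 5) => n.
have : 2 ^ n %% 3 != 0 by rewrite -/(3 %| _) Euclid_dvdX.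
move: (2 ^ n) => t t3; rewrite (_ : 2 ^ 5 = 32) //.
have [t1|t2] : t %% 3 = 1 \/ t %% 3 = 2 by lia.
- by apply: (@dvdn_mul 3 2); lia.
- by apply: (@dvdn_mul 2 3); lia.
Qed.

Theorem theorem3p15 (m : nat) (F : finFieldType) (hm : 5 <= m)
    (hF : #|F| = 2 ^ m) :
  exists lambda5 : nat,
    (lambda5%:R = (2 ^+ m - 8) * (2 ^+ m - 16) / (3`!)%:R :> rat)%R /\
    is_gdd (X01 F) (W F 2) (W F 5) (2 ^ m - 2) 2 5 lambda5.
Proof.
have char2 : (2%:R = 0 :> F)%R by apply/pcharf0/(card_finPcharP hF).
have dvd6 := dvdn6_pow2 hm.
(* This bound makes the truncated subtractions agree with those in [rat]. *)
have le16 : 16 <= 2 ^ m by rewrite (@leq_exp2l 2 4) // ltnW.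
exists ((2 ^ m - 8) * (2 ^ m - 16) %/ 6); split; last exact: W5_gdd.
rewrite (_ : 3`! = 6) //; apply: (canRL (mulfK _)) => //.
by rewrite -natrM divnK // natrM !natrB ?natrX // (leq_trans _ le16).
Qed.
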